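(* Consider the two-person game with pure strategy sets $\{a,b\}$, $\{a,b\}$ and payoff functions $u_1,u_2:\{a,b\}\times\{a,b\}\to\mathbb R$ given by $$u_1(a,a)=3,\quad u_1(a,b)=0,\quad u_1(b,a)=1,\quad u_1(b,b)=2,$$ $$u_2(a,a)=0,\quad u_2(a,b)=3,\quad u_2(b,a)=2,\quad u_2(b,b)=1.$$ For $(\nu_1,\nu_2)\in M_\cup(\{a,b\})\times M_\cup(\{a,b\})$ and $i\in\{1,2\}$ let $$cu_i(\nu_1,\nu_2)=\int^{Ch}_{\{a,b\}\times\{a,b\}} u_i\,d(\nu_1\circledast\nu_2)$$ be the Choquet integral of $u_i$ with respect to the tensor product $\nu_1\circledast\nu_2$ generated by the minimum operation. Then the game in mixed strategies with payoff functions $cu_1,cu_2$ has no Nash min-equilibrium point; that is, there is no pair $(\nu_1,\nu_2)\in M_\cup(\{a,b\})\times M_\cup(\{a,b\})$ such that $cu_1(\nu_1',\nu_2)\ge cu_1(\nu_1,\nu_2)$ for all $\nu_1'\in M_\cup(\{a,b\})$ and $cu_2(\nu_1,\nu_2')\ge cu_2(\nu_1,\nu_2)$ for all $\nu_2'\in M_\cup(\{a,b\})$.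
   Context: For a finite (discrete) set $X$, a possibility capacity on $X$ is a function $\nu$ from the subsets of $X$ to $[0,1]$ with $\nu(\emptyset)=0$, $\nu(X)=1$ and $\nu(A\cup B)=\max\{\nu(A),\nu(B)\}$ for all $A,B\subset X$. $M_\cup X$ is the set of possibility capacities on $X$. The density of $\nu$ is $[\nu]:X\to[0,1]$, $[\nu](x)=\nu(\{x\})$; one has $\nu(F)=\max_{x\in F}[\nu](x)$ for nonempty $F$, and every $f:X\to[0,1]$ with $\max f=1$ is the density of a unique possibility capacity. The tensor product generated by the minimum operation: for $\nu_1\in M_\cup X_1$, $\nu_2\in M_\cup X_2$, $\nu_1\circledast\nu_2\in M_\cup(X_1\times X_2)$ is the possibility capacity with density $[\nu_1\circledast\nu_2](x,y)=\min\{[\nu_1](x),[\nu_2](y)\}$. The Choquet integral of $f:X\to[0,+\infty)$ with respect to a capacity $\mu$ is $\int_X^{Ch}f\,d\mu=\int_0^\infty\mu(\{x\in X\mid f(x)\ge t\})\,dt$. *)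

(* Defs.v *)
From HB Require Import structures.
From mathcomp Require Import all_boot all_order all_algebra.
From mathcomp Require Import all_classical all_reals all_analysis.

Set Implicit Arguments.
Unset Strict Implicit.
Unset Printing Implicit Defensive.

Import Order.TTheory GRing.Theory Num.Theory.

Local Open Scope ring_scope.

(* Unqualified [set0], [setT] would be the ones of classical_sets. *)
Record poss_capacity (R : realType) (X : finType) := PossCapacity {
  cap :> {set X} -> R;
  cap_ge0 : forall A, 0 <= cap A;
  cap_le1 : forall A, cap A <= 1;
  cap0 : cap finset.set0 = 0;
  capT : cap (finset.setTfor X) = 1;
  capU : forall A B, cap (A :|: B)%SET = Num.max (cap A) (cap B) }.

Definition density (R : realType) (X : finType) (nu : poss_capacity R X)
  (x : X) : R := nu [set x]%SET.

Section FromDensity.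
Variables (R : realType) (X : finType) (f : X -> R).
Hypothesis f_ge0 : forall x, 0 <= f x.
Hypothesis f_le1 : forall x, f x <= 1.
Hypothesis f_eq1 : exists x, f x = 1.

Definition max_over (A : {set X}) : R := \big[Num.max/0]_(x in A) f x.

Lemma max_over_ge0 A : 0 <= max_over A.
Proof.
rewrite /max_over; apply: (big_ind (fun y => 0 <= y)) => // x y x0 y0.
by rewrite le_max x0.
Qed.

Lemma max_over_le1 A : max_over A <= 1.
Proof.
rewrite /max_over; apply: (big_ind (fun y => y <= 1)) => // x y x1 y1.
by rewrite ge_max x1.
Qed.

Lemma max_overP A c : 0 <= c ->
  max_over A <= c <-> (forall x, x \in A -> f x <= c).
Proof.
move=> c0; split=> [h x xA|h].
  by apply: le_trans h; apply: le_bigmax_cond.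
rewrite /max_over; apply: (big_ind (fun y => y <= c)) => // x y xc yc.
by rewrite ge_max xc.
Qed.

Lemma max_over0 : max_over finset.set0 = 0.
Proof.
apply/eqP; rewrite eq_le max_over_ge0 andbT.
by apply/max_overP => // x; rewrite inE.
Qed.

Lemma max_overT : max_over (finset.setTfor X) = 1.
Proof.
have [x fx] := f_eq1; apply/eqP; rewrite eq_le max_over_le1 /=.
rewrite -{1}fx; have /max_overP := lexx (max_over (finset.setTfor X)).
by apply; rewrite ?inE// max_over_ge0.
Qed.

Lemma max_overU A B : max_over (A :|: B)%SET = Num.max (max_over A) (max_over B).
Proof.
have mge0 : 0 <= Num.max (max_over A) (max_over B) by rewrite le_max max_over_ge0.
have le_max_over (C : {set X}) x : x \in C -> f x <= max_over C.
  by move=> xC; apply: (iffLR (max_overP C (max_over_ge0 C))).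
apply/eqP; rewrite eq_le; apply/andP; split.
  apply/max_overP => // x; rewrite inE le_max => /orP[] xC.
    by rewrite le_max_over.
  by rewrite (le_max_over B) ?orbT.
rewrite ge_max; apply/andP; split; apply/max_overP; rewrite ?max_over_ge0// => x xC;
  by apply: le_max_over; rewrite inE xC ?orbT.
Qed.

Definition poss_of_density : poss_capacity R X :=
  PossCapacity max_over_ge0 max_over_le1 max_over0 max_overT max_overU.

Lemma density_poss_of_density x : density poss_of_density x = f x.
Proof.
rewrite /density /=; apply/eqP; rewrite eq_le; apply/andP; split.
  by apply/max_overP => // y; rewrite inE => /eqP ->.
by apply: (iffLR (max_overP _ (max_over_ge0 _)) (lexx _)); rewrite inE.
Qed.

End FromDensity.

Section Tensor.
Variables (R : realType) (X1 X2 : finType).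
Variables (nu1 : poss_capacity R X1) (nu2 : poss_capacity R X2).

Definition tensor_density (z : X1 * X2) : R :=
  Num.min (density nu1 z.1) (density nu2 z.2).

Lemma density_eq1 (X : finType) (nu : poss_capacity R X) :
  exists x, density nu x = 1.
Proof.
have [//|no] := pselect (exists x, density nu x = 1).
have nu_lt1 n : forall A : {set X}, #|A| = n -> nu A < 1.
  elim: n => [A /eqP|n IH A An].
    by rewrite cards_eq0 => /eqP ->; rewrite cap0 ltr01.
  have /card_gt0P[x xA] : (0 < #|A|)%N by rewrite An.
  rewrite -(finset.setD1K xA) capU gt_max; apply/andP; split.
    by rewrite lt_neqAle cap_le1 andbT; apply/eqP => h; apply: no; exists x.
  by apply: IH; move: An; rewrite (cardsD1 x) xA => -[].
have := nu_lt1 _ _ (erefl #|finset.setTfor X|).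
by rewrite capT ltxx.
Qed.

Lemma tensor_density_ge0 z : 0 <= tensor_density z.
Proof. by rewrite le_min !cap_ge0. Qed.

Lemma tensor_density_le1 z : tensor_density z <= 1.
Proof. by rewrite ge_min !cap_le1. Qed.

Lemma tensor_density_eq1 : exists z, tensor_density z = 1.
Proof.
have [x hx] := density_eq1 nu1; have [y hy] := density_eq1 nu2.
by exists (x, y); rewrite /tensor_density /= hx hy minxx.
Qed.

Definition tensor : poss_capacity R (X1 * X2)%type :=
  poss_of_density tensor_density_ge0 tensor_density_le1 tensor_density_eq1.

Lemma density_tensor x y :
  density tensor (x, y) = Num.min (density nu1 x) (density nu2 y).
Proof. exact: density_poss_of_density. Qed.

End Tensor.

(* Meant for f >= 0 only: the integral ignores negative levels. *)
Definition choquet (R : realType) (X : finType) (f : X -> R)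
    (mu : {set X} -> R) : R :=
  \int[@lebesgue_measure R]_(t in `[0, +oo[%classic) mu [set x | t <= f x]%SET.

Definition choquet_payoff (R : realType) (X1 X2 : finType) (u : X1 * X2 -> R)
    (nu1 : poss_capacity R X1) (nu2 : poss_capacity R X2) : R :=
  choquet u (tensor nu1 nu2).

(* Both players minimize. *)
Definition nash_min_equilibrium (R : realType) (S1 S2 : Type)
    (p1 p2 : S1 -> S2 -> R) (s1 : S1) (s2 : S2) : Prop :=
  (forall s1', p1 s1' s2 >= p1 s1 s2) /\ (forall s2', p2 s1 s2' >= p2 s1 s2).

Inductive strategy := Sa | Sb.

Definition bool_of_strategy (s : strategy) := if s is Sa then true else false.
Definition strategy_of_bool (c : bool) := if c then Sa else Sb.

Lemma bool_of_strategyK : cancel bool_of_strategy strategy_of_bool.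
Proof. by case. Qed.

HB.instance Definition _ := Finite.copy strategy (can_type bool_of_strategyK).

Definition u1 (R : realType) (s : strategy * strategy) : R :=
  match s with
  | (Sa, Sa) => 3
  | (Sa, Sb) => 0
  | (Sb, Sa) => 1
  | (Sb, Sb) => 2
  end.

Definition u2 (R : realType) (s : strategy * strategy) : R :=
  match s with
  | (Sa, Sa) => 0
  | (Sa, Sb) => 3
  | (Sb, Sa) => 2
  | (Sb, Sb) => 1
  end.

(* Main.v *)
(* Payoffs with natural values turn the Choquet integral into a finite sum of
   capacities of upper level sets.  With p, q the densities of nu1 at a, b and
   r, s those of nu2,
     cu_1 = max(r, min(q,s)) + max(min(p,r), min(q,s)) + min(p,r),
     cu_2 = max(s, min(q,r)) + max(min(p,s), min(q,r)) + min(p,s).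
   Deviations to the pure strategies alone give cu_1 <= min(3r, 1 + s) and
   cu_2 <= min(2q, 1 + 2p), which is incompatible with
   max(p, q) = max(r, s) = 1. *)
Require Import Defs.
From HB Require Import structures.
From mathcomp Require Import all_boot all_order all_algebra.
From mathcomp Require Import all_classical all_reals all_analysis.
From mathcomp Require Import measurable_realfun lra.

Import Order.TTheory GRing.Theory Num.Theory.

Local Open Scope ring_scope.

Lemma le_poss_capacity (R : realType) (X : finType) (nu : poss_capacity R X)
    (A B : {set X}) : A \subset B -> nu A <= nu B.
Proof. by move=> /finset.setUidPr <-; rewrite capU le_max lexx. Qed.

(** Upper level sets shrink as the level grows, so the integrand is nonincreasing in [t]. *)
Lemma measurable_choquet_integrand (R : realType) (X : finType) (f : X -> R)
    (nu : poss_capacity R X) (D : set R) : measurable D ->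
  measurable_fun D (fun t => nu [set x | t <= f x]%SET).
Proof.
move=> mD; apply: nonincreasing_measurable => // s t st.
by apply: le_poss_capacity; apply/fintype.subsetP => x; rewrite !inE; exact: le_trans.
Qed.

(** For [t] in []k, k+1]] the conditions [t <= g x] and [k < g x] agree, so the integrand is a step
    function. The cells are closed on the right because level sets use [<=]; level 0 lies in no
    cell, hence [0 < t]. *)
Lemma choquet_integrand_natr (R : realType) (X : finType) (g : X -> nat)
    (n : nat) (nu : poss_capacity R X) (t : R) :
  (forall x, (g x <= n)%N) -> 0 < t ->
  nu [set x | t <= (g x)%:R]%SET =
  \sum_(k < n) nu [set x | (k < g x)%N]%SET * \1_(`]k%:R, k.+1%:R]%classic) t.
Proof.
move=> gn t0.
(* The least natural number at or above [t] is a successor [j.+1], so [t] lies in cell [j] and in no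
   other. *)
have Pt : exists m, t <= m%:R by exists (Num.bound t); apply/ltW/archi_boundP/ltW.
case: (ex_minnP Pt) => -[|j]; first by rewrite leNgt t0.
move=> tj jmin.
have jt : j%:R < t by rewrite ltNge; apply/negP => /jmin; rewrite ltnn.
have tE m : (t <= m%:R) = (j < m)%N.
  by apply/idP/idP => [/jmin //|jm]; rewrite (le_trans tj)// ler_nat.
have indE k : \1_(`]k%:R, k.+1%:R]%classic) t = (k == j)%:R :> R.
  rewrite indicE mem_setE in_itv /= tE ltnS; congr (nat_of_bool _)%:R.
  by rewrite ltNge tE -leqNgt eqn_leq.
under eq_finset do rewrite tE.
under eq_bigr do rewrite indE.
have [jn|nj] := ltnP j n.
  rewrite (bigD1 (Ordinal jn)) //= eqxx mulr1 big1 ?addr0// => i.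
  by rewrite -val_eqE /= => /negPf ->; rewrite mulr0.
(* Here [t] exceeds [n]: no cell of the sum contains it, and its level set is empty. *)
rewrite big1 => [|i _]; last by rewrite ltn_eqF ?mulr0 ?(leq_trans _ nj).
rewrite (_ : finset _ = finset.set0) ?cap0//.
by apply/setP => x; rewrite !inE ltnNge (leq_trans (gn x) nj).
Qed.

(** Each cell []k, k+1]] has length 1, so it contributes exactly the capacity of its level set. *)
Lemma choquet_natr (R : realType) (X : finType) (g : X -> nat) (n : nat)
    (nu : poss_capacity R X) : (forall x, (g x <= n)%N) ->
  choquet (fun x => (g x)%:R) nu = \sum_(k < n) nu [set x | (k < g x)%N]%SET.
Proof.
move=> gn.
have itv1 k : lebesgue_measure (`]k%:R, k.+1%:R]%classic : set R) = 1%E.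
  by rewrite lebesgue_measure_itv /= lte_fin ltr_nat ltnSn -EFinB -natrB// subSnn.
(* Level 0, where the step formula fails, is a null set and is removed from the domain. *)
rewrite /choquet /Rintegral -integral_itv_obnd_cbnd; last first.
  by apply/measurable_EFinP; exact: measurable_choquet_integrand.
under eq_integral => t.
  rewrite inE /= in_itv /= andbT => t0.
  rewrite (choquet_integrand_natr _ _ _ n) // -sumEFin.
  under eq_bigr do rewrite EFinM.
  over.
rewrite ge0_integral_sum //; last first.
- by move=> k t _; rewrite -EFinM lee_fin mulr_ge0 ?cap_ge0.
- move=> k; apply/measurable_EFinP; apply: measurable_funM => //.
rewrite (eq_bigr (fun k : 'I_n => (nu [set x | (k < g x)%N]%SET)%:E)); last first.
  move=> k _; rewrite ge0_integralZl_EFin ?cap_ge0//; last exact/measurable_EFinP.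
  rewrite integral_indic // setIidl; last first.
    move=> t /=; rewrite !in_itv /= andbT => /andP[+ _].
    exact: le_lt_trans.
  by rewrite -[RHS]mule1; congr (_ * _)%E; exact: itv1.
by rewrite sumEFin.
Qed.

Definition dirac_density (R : realType) (X : finType) (x y : X) : R :=
  (y == x)%:R.

Lemma dirac_density_ge0 (R : realType) (X : finType) (x y : X) :
  0 <= dirac_density R X x y.
Proof. exact: ler0n. Qed.

Lemma dirac_density_le1 (R : realType) (X : finType) (x y : X) :
  dirac_density R X x y <= 1.
Proof. by rewrite /dirac_density lern1 leq_b1. Qed.

Lemma dirac_density_eq1 (R : realType) (X : finType) (x : X) :
  exists y, dirac_density R X x y = 1.
Proof. by exists x; rewrite /dirac_density eqxx. Qed.

(** The pure strategy [x] seen as a mixed one; the equilibrium is tested only against such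
    deviations. *)
Definition dirac_capacity (R : realType) (X : finType) (x : X) :
    poss_capacity R X :=
  poss_of_density (dirac_density_ge0 R X x) (dirac_density_le1 R X x)
    (dirac_density_eq1 R X x).

Lemma density_dirac (R : realType) (X : finType) (x y : X) :
  density (dirac_capacity R X x) y = (y == x)%:R.
Proof. exact: density_poss_of_density. Qed.

(** The three terms are the capacities of the sets where the payoff exceeds 0, 1 and 2. In the
    first, [max(min(p,r), min(q,r))] is [r], because [max(p,q) = 1]. *)
Lemma choquet_payoff_u1 (R : realType) (nu1 nu2 : poss_capacity R strategy) :
  let p := density nu1 Sa in let q := density nu1 Sb in
  let r := density nu2 Sa in let s := density nu2 Sb in
  choquet_payoff (@u1 R) nu1 nu2 =
  Num.max (Num.max (Num.min p r) (Num.min q r)) (Num.min q s) +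
  Num.max (Num.min p r) (Num.min q s) + Num.min p r.
Proof.
move=> /=; pose g z := match z with
  (Sa, Sa) => 3 | (Sa, Sb) => 0 | (Sb, Sa) => 1 | (Sb, Sb) => 2 end%N.
rewrite /choquet_payoff (_ : @u1 R = fun z => (g z)%:R); last first.
  by apply/funext => -[[] []].
rewrite (choquet_natr _ _ _ 3%N); last by move=> -[[] []].
(* Minima become tensor capacities of singletons, and [capU] merges their maxima into capacities of
   level sets. *)
rewrite !big_ord_recl big_ord0 addr0 addrA -!density_tensor /density.
rewrite -!capU.
by congr (_ + _ + _); congr (cap _ _); apply/setP => -[[] []]; rewrite !inE.
Qed.

(** Swapping the two strategies of player 2 turns [u1] into [u2], so this is the previous formula
    with [r] and [s] exchanged. *)
Lemma choquet_payoff_u2 (R : realType) (nu1 nu2 : poss_capacity R strategy) :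
  let p := density nu1 Sa in let q := density nu1 Sb in
  let r := density nu2 Sa in let s := density nu2 Sb in
  choquet_payoff (@u2 R) nu1 nu2 =
  Num.max (Num.max (Num.min p s) (Num.min q s)) (Num.min q r) +
  Num.max (Num.min p s) (Num.min q r) + Num.min p s.
Proof.
move=> /=; pose g z := match z with
  (Sa, Sa) => 0 | (Sa, Sb) => 3 | (Sb, Sa) => 2 | (Sb, Sb) => 1 end%N.
rewrite /choquet_payoff (_ : @u2 R = fun z => (g z)%:R); last first.
  by apply/funext => -[[] []].
rewrite (choquet_natr _ _ _ 3%N); last by move=> -[[] []].
rewrite !big_ord_recl big_ord0 addr0 addrA -!density_tensor /density.
rewrite -!capU.
by congr (_ + _ + _); congr (cap _ _); apply/setP => -[[] []]; rewrite !inE.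
Qed.

Lemma density_strategy_max (R : realType) (nu : poss_capacity R strategy) :
  Num.max (density nu Sa) (density nu Sb) = 1.
Proof.
by rewrite -capU -(capT nu); congr (cap _ _); apply/setP => -[]; rewrite !inE.
Qed.

Theorem mainTheorem2 (R : realType) :
  ~ (exists (nu1 nu2 : poss_capacity R strategy),
       nash_min_equilibrium (choquet_payoff (@u1 R)) (choquet_payoff (@u2 R))
         nu1 nu2).
Proof.
move=> [nu1 [nu2 [eq1 eq2]]].
have := eq2 (dirac_capacity R _ Sb); have := eq2 (dirac_capacity R _ Sa).
have := eq1 (dirac_capacity R _ Sb); have := eq1 (dirac_capacity R _ Sa).
rewrite !choquet_payoff_u1 !choquet_payoff_u2 !density_dirac.
have := density_strategy_max R nu1; have := density_strategy_max R nu2.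
have [p0 p1] : 0 <= density nu1 Sa /\ density nu1 Sa <= 1.
  by rewrite cap_ge0 cap_le1.
have [q0 q1] : 0 <= density nu1 Sb /\ density nu1 Sb <= 1.
  by rewrite cap_ge0 cap_le1.
have [r0 r1] : 0 <= density nu2 Sa /\ density nu2 Sa <= 1.
  by rewrite cap_ge0 cap_le1.
have [s0 s1] : 0 <= density nu2 Sb /\ density nu2 Sb <= 1.
  by rewrite cap_ge0 cap_le1.
move: (density nu1 Sa) (density nu1 Sb) (density nu2 Sa) (density nu2 Sb)
  p0 p1 q0 q1 r0 r1 s0 s1 => p q r s p0 p1 q0 q1 r0 r1 s0 s1.
rewrite eqxx (_ : (Sb == Sa) = false) // (_ : (Sa == Sb) = false) //=.
rewrite !(min_r r1, min_r s1, min_l p1, min_l q1, min_l r0, min_l s0, min_r p0,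
  min_r q0, max_l p0, max_l r0, max_l s0, max_r r0, max_r s0, maxxx, max_r q0).
rewrite !(addr0, add0r).
have max_ge (x y : R) : x <= Num.max x y /\ y <= Num.max x y.
  by rewrite !le_max !lexx orbT.
have max3_ge (x y z : R) : [/\ x <= Num.max (Num.max x y) z,
    y <= Num.max (Num.max x y) z & z <= Num.max (Num.max x y) z].
  by rewrite !le_max !lexx !orbT.
(* The deviations to [Sb] still contain the maxima of [r], [s] and of [p], [q]; both equal 1. *)
move=> rs pq; rewrite rs pq (max_l (@ler01 R)).
(* The equilibrium payoffs are only bounded from above, so lower bounds on their maxima suffice; the
   maxima then become variables and the goal is linear up to minima. *)
have [+ + +] := max3_ge (Num.min p r) (Num.min q r) (Num.min q s).
have [+ + +] := max3_ge (Num.min p s) (Num.min q s) (Num.min q r).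
have [+ +] := max_ge (Num.min p r) (Num.min q s).
have [+ +] := max_ge (Num.min p s) (Num.min q r).
move: (Num.max (Num.max _ _) _) (Num.max (Num.max _ _) _) (Num.max (Num.min _ _) _)
   (Num.max (Num.min _ _) _) => A B C D.
move: rs pq; case: (leP s r) => sr rs; case: (leP q p) => qp pq; subst.
(* With [p = r = 1], [cu_1] is at least 3, above [1 + s]. *)
- by rewrite !(minxx, min_l q1, min_r s1); lra.
(* With [q = r = 1], [cu_1 <= 1 + s] forces [p = 0], while [2 <= cu_2 <= 1 + 2p]. *)
- by rewrite !(minxx, min_l p1, min_r s1); case: (leP p s) => ps; lra.
(* With [p = s = 1], [cu_2] is at least 3, above [2q]. *)
- by rewrite !(minxx, min_l q1, min_r r1); lra.
(* With [q = s = 1], [cu_2 <= 1 + 2p] forces [r <= p]; then [2 + r <= cu_1 <= 3r] contradicts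
   [r < 1]. *)
- by rewrite !(minxx, min_l p1, min_r r1); case: (leP p r) => pr; lra.
Qed.
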